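(* For any $\epsilon\in(0,1/3]$, any (possibly randomized) distributed algorithm in the $\mathsf{BCC}$ model that determines a $(4/3-\epsilon)$-approximation of the radius of an unweighted $n$-node graph with probability at least $2/3$ requires $\widetilde{\Omega}(n)$ rounds.
   Context: Distributed setting: $n$ nodes with unique IDs in $\{1,\dots,n\}$; the input is an undirected unweighted graph on these nodes, each node initially knowing only its incident edges. In the broadcast congested clique $\mathsf{BCC}$, computation proceeds in synchronous rounds with unlimited local computation, and in each round every node broadcasts the same $\mathcal{O}(\log n)$-bit message to all other nodes. The eccentricity of $u$ is $\mathrm{ecc}(u)=\max_v d(u,v)$, the radius is $R=\min_u\mathrm{ecc}(u)$, and an $\alpha$-approximation is a value $\widetilde R$ with $R\le\widetilde R\le\alpha R$. $\widetilde{\Omega}$ hides polylogarithmic factors in $n$. *)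

(* Defs.v *)
From HB Require Import structures.
From mathcomp Require Import all_boot all_order all_algebra.
From mathcomp Require Import reals.
Set Implicit Arguments. Unset Strict Implicit. Unset Printing Implicit Defensive.
Import Order.TTheory GRing.Theory Num.Theory.

(* ---------- Graphs on the node set 'I_n (IDs 1..n shifted to 0..n-1) ---------- *)
Definition graph (n : nat) := 'I_n -> 'I_n -> bool.

Definition simple_graph n (g : graph n) : Prop :=
  (forall u v, g u v = g v u) /\ (forall u, g u u = false).

Fixpoint within n (g : graph n) (k : nat) (u v : 'I_n) : bool :=
  if k is k'.+1 then within g k' u v || [exists w, within g k' u w && g w v]
  else u == v.

Definition connectedg n (g : graph n) : Prop := forall u v, within g n u v.

(* hop distance: least k with a walk of length <= k (equals n if none) *)
Definition dist n (g : graph n) (u v : 'I_n) : nat :=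
  find (fun k => within g k u v) (iota 0 n).

Definition ecc n (g : graph n) (u : 'I_n) : nat := \max_(v : 'I_n) dist g u v.

Definition radius n (g : graph n) : nat := \big[minn/n]_(u : 'I_n) ecc g u.

Definition round_msgs (n b : nat) := {ffun 'I_n -> 'I_(2 ^ b)}.

(* A (randomized) BCC algorithm on n nodes, b-bit messages, private random
   seed of each node uniform in 'I_K.  A node's behaviour depends on its own
   ID, its incident edges (its adjacency row), its private seed and the
   transcript of all messages broadcast in earlier rounds (unlimited local
   computation: arbitrary functions). *)
Record bcc_alg (R : Type) (n b K : nat) := BccAlg {
  bcc_msg : 'I_n -> {ffun 'I_n -> bool} -> 'I_K -> seq (round_msgs n b) -> 'I_(2 ^ b);
  bcc_out : 'I_n -> {ffun 'I_n -> bool} -> 'I_K -> seq (round_msgs n b) -> R }.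

Definition local_input n (g : graph n) (v : 'I_n) : {ffun 'I_n -> bool} :=
  [ffun u => g v u].

Fixpoint transcript R n b K (A : bcc_alg R n b K) (g : graph n)
    (seed : {ffun 'I_n -> 'I_K}) (t : nat) : seq (round_msgs n b) :=
  if t is t'.+1 then
    let tr := transcript A g seed t' in
    rcons tr [ffun v => bcc_msg A v (local_input g v) (seed v) tr]
  else [::].

Definition bcc_output R n b K (A : bcc_alg R n b K) (g : graph n)
    (seed : {ffun 'I_n -> 'I_K}) (T : nat) (v : 'I_n) : R :=
  bcc_out A v (local_input g v) (seed v) (transcript A g seed T).

Local Open Scope ring_scope.

Definition approx_ok (R : realType) (alpha x : R) (r : nat) : bool :=
  (r%:R <= x) && (x <= alpha * r%:R).

Definition bcc_success (R : realType) n b K (A : bcc_alg R n b K) (g : graph n)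
    (T : nat) (alpha : R) (seed : {ffun 'I_n -> 'I_K}) : bool :=
  [forall v, approx_ok alpha (bcc_output A g seed T v) (radius g)].

(* A runs in T rounds and, on every (connected, simple) input graph, succeeds
   with probability >= 2/3 over the uniform independent private seeds. *)
Definition bcc_radius_approx (R : realType) n b K (A : bcc_alg R n b K)
    (T : nat) (alpha : R) : Prop :=
  forall g : graph n, simple_graph g -> connectedg g ->
    (2 * K ^ n <= 3 * #|[set seed : {ffun 'I_n -> 'I_K} | bcc_success A g T alpha seed]|)%N.

(* Main.v *)
Require Import Defs.
From HB Require Import structures.
From mathcomp Require Import all_boot all_order all_algebra.
From mathcomp Require Import reals sequences exp.
From mathcomp Require Import zify ring lra.
Set Implicit Arguments. Unset Strict Implicit. Unset Printing Implicit Defensive.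
Import Order.TTheory GRing.Theory Num.Theory.
Local Open Scope ring_scope.

(** Two inputs x, y in {0,1}^(m x m), m = Theta(n), are encoded in a graph whose
    every node has a neighbourhood depending on x only or on y only, and whose
    radius is at most 3 if x and y intersect and at least 4 otherwise. A
    (4/3 - eps)-approximation of the radius therefore decides disjointness, and
    T rounds of b-bit broadcasts have at most 2^(bnT) transcripts, the inputs
    leading to a given transcript forming a rectangle.

    Disjointness is bounded from below by the information-theoretic argument of
    Bar-Yossef, Jayram, Kumar and Sivakumar. A set D of coordinates is given to
    x, its complement to y, and the owner of each coordinate fills it with the
    bit of a uniform z. The transcript takes few values, so on average over the
    coordinate i it hardly depends on z_i (this is the level-one inequality for
    the fibres of the transcript). Given D, the transcript distribution for the
    values (a, b) of x and y at i is a product f(a) g(b), so the Hellinger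
    distance between the cases (0,0) and (1,1) equals that between (0,1) and
    (1,0), which is small by the triangle inequality through (0,0). Hence the
    disjoint case (0,0) and the intersecting case (1,1) cannot be told apart
    unless bnT = Omega(m^2). *)

(** * Sums over the Boolean cube *)

Section Cube.
Variables (R : realType) (I : finType).
Local Notation cube := {ffun I -> bool}.
Implicit Types (z w D : cube) (i : I).

Definition upd z i a : cube := [ffun j => if j == i then a else z j].

Lemma upd_id z i a : z i = a -> upd z i a = z.
Proof. by move=> <-; apply/ffunP=> j; rewrite ffunE; case: eqP => [->|]. Qed.

Lemma updK z i a b : upd (upd z i a) i b = upd z i b.
Proof. by apply/ffunP=> j; rewrite !ffunE; case: eqP. Qed.

(** Overwriting bit [i] maps the cube two-to-one onto the half where that bit is [a]. *)
Lemma sum_upd (f : cube -> R) i a :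
  \sum_z f (upd z i a) = 2 * \sum_(z : cube | z i == a) f z.
Proof.
rewrite (bigID (fun z : cube => z i == a)) /= mulr2n mulrDl mul1r; congr (_ + _).
  by apply: eq_bigr => z /eqP/upd_id ->.
rewrite (reindex_onto (fun z => upd z i (~~ a)) (fun z => upd z i a)) /=; last first.
  by move=> z zi; rewrite updK upd_id //; apply/esym; move: zi; case: (z i) a => [] [].
apply: eq_big => [z|z /andP[_ /eqP zi]]; rewrite updK.
  have -> : upd z i (~~ a) i != a by rewrite ffunE eqxx; case: a.
  rewrite /=; apply/eqP/eqP => [<-|]; last exact: upd_id.
  by rewrite ffunE eqxx.
by rewrite -[in RHS]zi updK.
Qed.

Definition mix D z w : cube := [ffun j => if D j then z j else w j].

Lemma card_cube : #|{: cube}| = (2 ^ #|I|)%N.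
Proof. by rewrite card_ffun card_bool. Qed.

Lemma sum_cube1 : \sum_(z : cube) 1 = 2 ^+ #|I| :> R.
Proof. by rewrite sumr_const card_cube natrX. Qed.

Lemma sum_cube_const (x : R) : \sum_(z : cube) x = x * 2 ^+ #|I|.
Proof. by rewrite -sum_cube1 mulr_sumr mulr1. Qed.

(** Here [f] reads only bits in [D] and [g] only the others, so they are independent: exchanging the
    bits outside [D] between [z] and [w] is an involution on pairs that turns [f z * g z] into
    [f z * g w]. *)
Lemma mix_independent D (f g : cube -> R) :
  (forall z w, f (mix D z w) = f z) -> (forall z w, g (mix D z w) = g w) ->
  (\sum_z f z * g z) * 2 ^+ #|I| = (\sum_z f z) * (\sum_z g z).
Proof.
move=> hf hg; rewrite -sum_cube1 !big_distrlr /= !pair_big /=.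
have mixK : involutive (fun p : cube * cube => (mix D p.1 p.2, mix D p.2 p.1)).
  by move=> [z w] /=; congr pair; apply/ffunP=> j; rewrite !ffunE; case: (D j).
rewrite (reindex_inj (inv_inj mixK)) /=; apply: eq_bigr => -[z w] _ /=.
by rewrite hf hg mulr1.
Qed.

End Cube.

(** * The level-one inequality *)

Section LevelOne.
Variables (R : realType) (I W : finType).
Local Notation cube := {ffun I -> bool}.

Definition fibre (tau : cube -> W) i a w : R :=
  \sum_(z : cube | (tau z == w) && (z i == a)) 1.

Definition sgn (b : bool) : R := if b then 1 else -1.

Lemma fibre_ge0 tau i a w : 0 <= fibre tau i a w.
Proof. by apply: sumr_ge0. Qed.

Lemma sum_fibre tau i w (f : bool -> R) :
  \sum_(z : cube | tau z == w) f (z i) =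
  f true * fibre tau i true w + f false * fibre tau i false w.
Proof.
rewrite (bigID (fun z : cube => z i == true)) /= !mulr_sumr; congr (_ + _).
  by apply: eq_bigr => z /andP[_ /eqP ->]; rewrite mulr1.
rewrite (eq_bigl (fun z => (tau z == w) && (z i == false))); last first.
  by move=> z; case: (z i).
by apply: eq_bigr => z /andP[_ /eqP ->]; rewrite mulr1.
Qed.

(** Invert [1 + u <= expR u] at [u = 2 * t ^+ 2 - t]; then [(1 + t) * (1 + u) = 1 + t ^+ 2 * (1 + 2
    * t)] is at least 1 in the given range. *)
Lemma expR_le_add1 (t : R) : - 2^-1 <= t -> expR (t - 2 * t ^+ 2) <= 1 + t.
Proof.
move=> ht; rewrite -(opprK (t - _)) expRN.
have e1 := expR_ge1Dx (- (t - 2 * t ^+ 2)).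
have p0 : 0 < 1 + - (t - 2 * t ^+ 2) by nra.
apply: le_trans (_ : (1 + - (t - 2 * t ^+ 2))^-1 <= _).
  by rewrite lef_pV2 // posrE expR_gt0.
rewrite -[leLHS]mul1r ler_pdivrMr //; nra.
Qed.

Lemma sqr_sqrtB_le (a b : R) : 0 <= a -> 0 <= b ->
  (Num.sqrt a - Num.sqrt b) ^+ 2 <= ((a - b) / (a + b)) ^+ 2 * (a + b).
Proof.
move=> a0 b0; have := sqr_sqrtr a0; have := sqr_sqrtr b0.
have := sqrtr_ge0 a; have := sqrtr_ge0 b.
set s := Num.sqrt a; set t := Num.sqrt b => t0 s0 tE sE.
have [ab0|abn0] := eqVneq (a + b) 0.
  have -> : s = 0 by apply/eqP; rewrite sqrtr_eq0; lra.
  have -> : t = 0 by apply/eqP; rewrite sqrtr_eq0; lra.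
  by rewrite subrr expr0n /= mulr_ge0 ?sqr_ge0 // addr_ge0.
have ab_gt0 : 0 < a + b by rewrite lt_def abn0 addr_ge0.
have -> : ((a - b) / (a + b)) ^+ 2 * (a + b) = (a - b) ^+ 2 / (a + b) by field.
rewrite ler_pdivlMr // -sE -tE.
have -> : (s ^+ 2 - t ^+ 2) ^+ 2 = (s - t) ^+ 2 * (s + t) ^+ 2 by ring.
by apply: ler_wpM2l; [exact: sqr_ge0 | nra].
Qed.

(* The weights [Wt w] have mean 1 over the cube, whereas on the fibre of [w]
   they are at least [expR X], with [X] of large mean if the fibre is biased in
   many coordinates; Jensen's inequality, in the form of the tangent of [expR]
   at [c], compares the two. *)
Lemma level_one (tau : cube -> W) (c : nat) : (#|W| <= 2 ^ c)%N ->
  \sum_i \sum_w (Num.sqrt (fibre tau i true w) - Num.sqrt (fibre tau i false w)) ^+ 2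
    <= 8 * c%:R * 2 ^+ #|I|.
Proof.
move=> cardW.
pose a := fibre tau ^~ true; pose b := fibre tau ^~ false.
have a0 i w : 0 <= a i w by exact: fibre_ge0.
have b0 i w : 0 <= b i w by exact: fibre_ge0.
pose q i w := (a i w - b i w) / (a i w + b i w).
have q_bound i w : -1 <= q i w <= 1.
  have := a0 i w; have := b0 i w; rewrite /q; set x := b i w; set y := a i w => x0 y0.
  have [->|xy0] := eqVneq (y + x) 0; first by rewrite invr0 mulr0; lra.
  have xy_gt0 : 0 < y + x by rewrite lt_def xy0 addr_ge0.
  by rewrite ler_pdivlMr // ler_pdivrMr //; lra.
have qab i w : q i w * (a i w - b i w) = q i w ^+ 2 * (a i w + b i w).
  rewrite /q; have [ab0|/negP ab0] := eqVneq (a i w + b i w) 0.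
    by rewrite ab0 invr0 !(mulr0, mul0r).
  by field; apply/negP.
(* The scale 1/4 keeps the increments of [Wt] above -1/2, and [q ^+ 2 / 8] is twice the squared
   increment. *)
pose X z := \sum_i (q i (tau z) / 4 * sgn (z i) - q i (tau z) ^+ 2 / 8).
pose Wt w (z : cube) := \prod_i (1 + q i w / 4 * sgn (z i)).
have Wt0 w (z : cube) : 0 <= Wt w z.
  apply: prodr_ge0 => i _; have := q_bound i w; rewrite /sgn; case: (z i); lra.
have sumWt w : \sum_z Wt w z = 2 ^+ #|I|.
  rewrite -(bigA_distr_bigA (fun i e => 1 + q i w / 4 * sgn e)) /=.
  rewrite (eq_bigr (fun=> 2)) ?prodr_const // => i _.
  by rewrite big_bool /sgn /=; ring.
have WtX z : expR (X z) <= Wt (tau z) z.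
  rewrite /X expR_sum; apply: ler_prod => i _; rewrite expR_ge0 /=.
  have := q_bound i (tau z); set t := q i (tau z) => ht.
  have -> : t / 4 * sgn (z i) - t ^+ 2 / 8 =
      t / 4 * sgn (z i) - 2 * (t / 4 * sgn (z i)) ^+ 2.
    by rewrite /sgn; case: (z i); field.
  by apply: expR_le_add1; rewrite /sgn; case: (z i); lra.
have tangent z : expR c%:R * (1 + X z - c%:R) <= expR (X z).
  rewrite -(subrKC c%:R (X z)) expRD ler_pM2l ?expR_gt0 //.
  by rewrite subrKC; have := expR_ge1Dx (X z - c%:R); lra.
have sumX : \sum_z X z = 8^-1 * \sum_i \sum_w q i w ^+ 2 * (a i w + b i w).
  rewrite exchange_big mulr_sumr; apply: eq_bigr => i _ /=.
  rewrite (partition_big tau predT) //= mulr_sumr; apply: eq_bigr => w _.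
  rewrite (eq_bigr (fun z : cube => q i w / 4 * sgn (z i) - q i w ^+ 2 / 8)).
    rewrite (sum_fibre tau i w (fun e => q i w / 4 * sgn e - q i w ^+ 2 / 8)).
    have := qab i w; rewrite /sgn -/(a i w) -/(b i w); lra.
  by move=> z /eqP ->.
have main : expR c%:R * \sum_z (1 + X z - c%:R) <= expR c%:R * 2 ^+ #|I|.
  apply: le_trans (_ : \sum_z Wt (tau z) z <= _).
    rewrite mulr_sumr; apply: ler_sum => z _.
    exact: le_trans (tangent z) (WtX z).
  apply: le_trans (_ : \sum_w \sum_z Wt w z <= _).
    rewrite exchange_big /=; apply: ler_sum => z _.
    by rewrite (bigD1 (tau z)) //= lerDl sumr_ge0.
  under eq_bigr do rewrite sumWt.
  rewrite sumr_const -[leLHS]mulr_natl ler_wpM2r ?exprn_ge0 //.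
  (* The tangent point [c] suits because [expR c%:R] dominates [2 ^ c], hence the number of
     fibres. *)
  apply: le_trans (_ : (2 ^ c)%:R <= _); first by rewrite ler_nat.
  rewrite natrX -(mulr1 c%:R) expRM_natl lerXn2r ?nnegrE ?expR_ge0 //.
  by have := expR_ge1Dx (1 : R); lra.
move: main; rewrite ler_pM2l ?expR_gt0 // 2!big_split /= sumX.
rewrite !sum_cube_const => main.
apply: le_trans (_ : \sum_i \sum_w q i w ^+ 2 * (a i w + b i w) <= _); last by lra.
by apply: ler_sum => i _; apply: ler_sum => w _; apply: sqr_sqrtB_le; apply: fibre_ge0.
Qed.

End LevelOne.

(** * Unique disjointness *)

Section UniqueDisjointness.
Variables (R : realType) (I W : finType).
Local Notation cube := {ffun I -> bool}.
Variable pi : cube -> cube -> W.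
Hypothesis pi_rect : forall x y x' y', pi x y' = pi x' y -> pi x y = pi x y'.
Implicit Types (D z x y : cube) (i : I).

(** Away from [i] no coordinate is 1 in both players' inputs, so they intersect only if [a] and [b]
    are both true. *)
Definition alice D z i a : cube := [ffun j => if j == i then a else D j && z j].
Definition bob D z i b : cube := [ffun j => if j == i then b else ~~ D j && z j].

Definition freq D i a b w : R :=
  \sum_(z : cube | pi (alice D z i a) (bob D z i b) == w) 1.

Lemma freq_ge0 D i a b w : 0 <= freq D i a b w.
Proof. by apply: sumr_ge0. Qed.

Lemma sum_freqM D i a b (f : W -> R) :
  \sum_w f w * freq D i a b w = \sum_z f (pi (alice D z i a) (bob D z i b)).
Proof.
rewrite (partition_big (fun z => pi (alice D z i a) (bob D z i b)) predT) //=.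
apply: eq_bigr => w _; rewrite mulr_sumr.
by apply: eq_bigr => z /eqP ->; rewrite mulr1.
Qed.

Lemma sum_freq D i a b : \sum_w freq D i a b w = 2 ^+ #|I|.
Proof.
rewrite -sum_cube1 -(sum_freqM D i a b (fun=> 1)).
by apply: eq_bigr => w _; rewrite mul1r.
Qed.

Lemma freq_upd D i d a b w : freq (upd D i d) i a b w = freq D i a b w.
Proof.
apply: eq_bigl => z; congr (pi _ _ == _); apply/ffunP=> j; rewrite !ffunE;
  by case: (j == i).
Qed.

(* Given [D], the two inputs depend on disjoint sets of bits of [z]. *)
Lemma freq_product D i w : exists f g : bool -> R,
  [/\ forall a, 0 <= f a, forall b, 0 <= g b
    & forall a b, freq D i a b w = f a * g b].
Proof.
pose al x := [exists y, pi x y == w]; pose be y := [exists x, pi x y == w].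
have piE x y : (pi x y == w) = al x && be y.
  apply/idP/andP => [xy|[/existsP[y' /eqP xy'] /existsP[x' /eqP xy]]].
    by split; apply/existsP; [exists y | exists x].
  by rewrite (@pi_rect x y x' y') xy' // xy.
pose f a := \sum_z (al (alice D z i a))%:R : R.
pose g b := \sum_z (be (bob D z i b))%:R : R.
have N0 : 2 ^+ #|I| != 0 :> R by rewrite expf_neq0 // pnatr_eq0.
exists f, (fun b => g b / 2 ^+ #|I|); split=> [a|b|a b].
- exact: sumr_ge0.
- by rewrite divr_ge0 ?exprn_ge0 ?sumr_ge0.
rewrite mulrA -(mix_independent (D := D)); first last.
- move=> z z'; congr (be _)%:R; apply/ffunP=> j; rewrite !ffunE.
  by case: (D j); rewrite ?andbF.
- move=> z z'; congr (al _)%:R; apply/ffunP=> j; rewrite !ffunE.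
  by case: (D j); rewrite ?andbF.
rewrite mulfK // /freq big_mkcond /=; apply: eq_bigr => z _.
by rewrite piE; case: (al _); case: (be _); rewrite /= ?mulr1 ?mulr0.
Qed.

(** The squared Hellinger distance up to normalisation: each [freq] has total mass [2 ^+ #|I|]. *)
Definition hellinger D i (a b a' b' : bool) : R :=
  \sum_w (Num.sqrt (freq D i a b w) - Num.sqrt (freq D i a' b' w)) ^+ 2.

Lemma hellinger_cut_paste D i :
  hellinger D i false false true true <=
  2 * (hellinger D i true false false false + hellinger D i false true false false).
Proof.
(* All four histograms have equal mass. Subtracting this null sum turns the summand for (0,0) and
   (1,1) into that for (0,1) and (1,0): by the product form both have the same cross term. *)
have zero : \sum_w (freq D i false false w + freq D i true true w
                    - freq D i false true w - freq D i true false w) = 0.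
  by rewrite !big_split /= !sumrN !sum_freq; ring.
rewrite -[leLHS]subr0 -zero -sumrB -big_split mulr_sumr /=.
apply: ler_sum => w _; have [f [g [f0 g0 fgE]]] := freq_product D i w.
rewrite !fgE !sqrtrM //.
have := sqr_sqrtr (f0 true); have := sqr_sqrtr (f0 false).
have := sqr_sqrtr (g0 true); have := sqr_sqrtr (g0 false).
set s1 := Num.sqrt (f true); set s0 := Num.sqrt (f false).
set t1 := Num.sqrt (g true); set t0 := Num.sqrt (g false).
move=> <- <- <- <-; rewrite -subr_ge0.
have -> : 2 * ((s1 * t0 - s0 * t0) ^+ 2 + (s0 * t1 - s0 * t0) ^+ 2)
  - ((s0 * t0 - s1 * t1) ^+ 2 - (s0 ^+ 2 * t0 ^+ 2 + s1 ^+ 2 * t1 ^+ 2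
       - s0 ^+ 2 * t1 ^+ 2 - s1 ^+ 2 * t0 ^+ 2))
  = (s0 * t1 - s0 * t0 + (s1 * t0 - s0 * t0)) ^+ 2 by ring.
exact: sqr_ge0.
Qed.

Definition split_input D z := pi [ffun j => D j && z j] [ffun j => ~~ D j && z j].

(** The owner of [i] holds [a] and the other player 0, as in [split_input]; the factor 2 arises
    because [freq] overwrites [z i], leaving it free. *)
Lemma freq_fibre D i a w :
  freq D i (D i && a) (~~ D i && a) w = 2 * fibre R (split_input D) i a w.
Proof.
have -> : fibre R (split_input D) i a w =
    \sum_(z : cube | z i == a) (split_input D z == w)%:R.
  rewrite /fibre big_mkcond [RHS]big_mkcond /=; apply: eq_bigr => z _.
  by case: (_ == w); case: (_ == a).
rewrite -sum_upd /freq big_mkcond /=; apply: eq_bigr => z _.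
have -> : alice D z i (D i && a) = [ffun j => D j && upd z i a j].
  by apply/ffunP=> j; rewrite !ffunE; case: eqP => [->|].
have -> : bob D z i (~~ D i && a) = [ffun j => ~~ D j && upd z i a j].
  by apply/ffunP=> j; rewrite !ffunE; case: eqP => [->|].
by rewrite /split_input; case: (_ == w).
Qed.

Lemma information_bound D c : (#|W| <= 2 ^ c)%N ->
  \sum_i hellinger D i (D i) (~~ D i) false false <= 16 * c%:R * 2 ^+ #|I|.
Proof.
move=> /(level_one R (split_input D)) le1.
apply: le_trans (_ : 2 * (8 * c%:R * 2 ^+ #|I|) <= _); last by lra.
apply: le_trans (ler_wpM2l _ le1) => //; rewrite mulr_sumr.
apply: ler_sum => i _; rewrite mulr_sumr; apply: ler_sum => w _.
have -> : freq D i (D i) (~~ D i) w = 2 * fibre R (split_input D) i true w.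
  by rewrite -freq_fibre !andbT.
have -> : freq D i false false w = 2 * fibre R (split_input D) i false w.
  by rewrite -freq_fibre !andbF.
by rewrite !sqrtrM // -mulrBr exprMn sqr_sqrtr.
Qed.

Lemma hellinger_upd D i d a b a' b' :
  hellinger (upd D i d) i a b a' b' = hellinger D i a b a' b'.
Proof. by apply: eq_bigr => w _; rewrite !freq_upd. Qed.

Lemma sum_hellinger_bound c : (#|W| <= 2 ^ c)%N ->
  \sum_D \sum_i (hellinger D i true false false false
                  + hellinger D i false true false false)
    <= 32 * c%:R * (2 ^+ #|I| * 2 ^+ #|I|).
Proof.
move=> cW.
have -> : \sum_D \sum_i (hellinger D i true false false false
                         + hellinger D i false true false false)
    = 2 * \sum_D \sum_i hellinger D i (D i) (~~ D i) false false.
  rewrite exchange_big [in RHS]exchange_big mulr_sumr; apply: eq_bigr => i _ /=.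
  (* [hellinger] at [i] ignores [D i], so the sets [D] giving [i] to one fixed player contribute
     half of the full sum. *)
  have half a : \sum_(D : cube) hellinger D i a (~~ a) false false =
      2 * \sum_(D : cube | D i == a) hellinger D i a (~~ a) false false.
    by rewrite -sum_upd; apply: eq_bigr => D _; rewrite hellinger_upd.
  rewrite big_split /= (half true) (half false) -mulrDr; congr (_ * _).
  rewrite [RHS](bigID (fun D : cube => D i == true)) /=; congr (_ + _).
    by apply: eq_bigr => D /eqP ->.
  by apply: eq_big => [D|D /eqP ->]; first by case: (D i).
apply: le_trans (_ : 2 * \sum_(D : cube) (16 * c%:R * 2 ^+ #|I|) <= _).
  by rewrite ler_pM2l //; apply: ler_sum => D _; exact: information_bound.
by rewrite sum_cube_const; lra.
Qed.

Theorem unique_disjointness (F : W -> bool) c : (#|W| <= 2 ^ c)%N ->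
  \sum_D \sum_i \sum_z ((F (pi (alice D z i false) (bob D z i false)))%:R
                        - (F (pi (alice D z i true) (bob D z i true)))%:R)
    <= (384 * c%:R + #|I|%:R / 6) * (2 ^+ #|I| * 2 ^+ #|I|) :> R.
Proof.
move=> cW; set N := 2 ^+ #|I|.
have step D i : \sum_z ((F (pi (alice D z i false) (bob D z i false)))%:R
                        - (F (pi (alice D z i true) (bob D z i true)))%:R)
    <= 12 * (hellinger D i true false false false
             + hellinger D i false true false false)
       + N / 6 :> R.
  apply: le_trans (_ : 6 * hellinger D i false false true true + N / 6 <= _); last first.
    by have := hellinger_cut_paste D i; lra.
  (* Pointwise, [p - q] is at most 6 times the squared difference of the square roots plus
     [(p + q) / 12]. The last term sums to [N / 6], half of the gap 1/3 that success probability 2/3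
     guarantees. *)
  have -> : N / 6 = \sum_w (freq D i false false w + freq D i true true w) / 12.
    by rewrite -mulr_suml big_split /= !sum_freq -/N; field.
  rewrite sumrB -!(sum_freqM D i _ _ (fun w => (F w)%:R)) -sumrB mulr_sumr.
  rewrite -big_split /=; apply: ler_sum => w _.
  have p0 := freq_ge0 D i false false w; have q0 := freq_ge0 D i true true w.
  have := sqr_sqrtr p0; have := sqr_sqrtr q0.
  set s := Num.sqrt (freq D i false false w); set t := Num.sqrt (freq D i true true w).
  move=> tE sE; have st0 := sqr_ge0 (s - t).
  case: (F w); rewrite /= ?mulr1n ?mul1r ?mul0r; last by lra.
  rewrite -sE -tE -subr_ge0.
  have -> : 6 * (s - t) ^+ 2 + (s ^+ 2 + t ^+ 2) / 12 - (s ^+ 2 - t ^+ 2)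
    = 6 * (s - t - (s + t) / 12) ^+ 2 + (s - t) ^+ 2 / 24 by field.
  by have := sqr_ge0 (s - t - (s + t) / 12); lra.
apply: le_trans (_ : \sum_D \sum_i (12 * (hellinger D i true false false false
    + hellinger D i false true false false) + N / 6) <= _).
  by apply: ler_sum => D _; apply: ler_sum => i _; exact: step.
under eq_bigr => D _ do rewrite big_split /= -mulr_sumr sumr_const -[_ *+ _]mulr_natl.
rewrite big_split /= -mulr_sumr.
rewrite sum_cube_const -/N.
have := sum_hellinger_bound cW; rewrite -/N; lra.
Qed.

End UniqueDisjointness.

(** * Distances and radius *)

Section Walks.
Variables (n : nat) (g : graph n).
Implicit Types u v w : 'I_n.

Lemma within_mono k l u v : (k <= l)%N -> within g k u v -> within g l u v.
Proof.
elim: l => [|l IHl]; first by rewrite leqn0 => /eqP ->.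
by rewrite leq_eqVlt ltnS => /predU1P[->//|/IHl IH] /IH /= ->.
Qed.

Lemma within_trans k l u v w :
  within g k u v -> within g l v w -> within g (k + l) u w.
Proof.
move=> uv; elim: l w => [|l IHl] w; first by rewrite addn0 => /eqP <-.
rewrite addnS /= => /orP[/IHl -> //|/existsP[v' /andP[/IHl uv' v'w]]].
by apply/orP; right; apply/existsP; exists v'; rewrite uv'.
Qed.

Lemma within_edge u v : g u v -> within g 1 u v.
Proof. by move=> uv; apply/orP; right; apply/existsP; exists u; rewrite /= eqxx. Qed.

Lemma within_sym k u v : (forall u v, g u v = g v u) -> within g k u v -> within g k v u.
Proof.
move=> gsym; elim: k v => [|k IHk] v; first by rewrite /= eq_sym.
move=> /= /orP[/IHk -> //|/existsP[w /andP[/IHk uw wv]]].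
change (within g k.+1 v u); rewrite -add1n; apply: within_trans uw.
by apply: within_edge; rewrite gsym.
Qed.

Lemma within_lipschitz (f : 'I_n -> nat) k u v :
  (forall u v, g u v -> f v <= (f u).+1)%N -> within g k u v -> (f v <= f u + k)%N.
Proof.
move=> flip; elim: k v => [|k IHk] v; first by rewrite addn0 => /eqP ->.
rewrite addnS => /= /orP[/IHk /leqW //|/existsP[w /andP[/IHk uw /flip wv]]].
exact: leq_trans wv _.
Qed.

(** [dist] defaults to [n] when no walk is found, hence the range [k < n]. *)
Lemma dist_le k u v : (k < n)%N -> (dist g u v <= k)%N = within g k u v.
Proof.
move=> kn; apply/idP/idP => [dk|wk].
  have dn := leq_ltn_trans dk kn.
  apply: within_mono dk _; rewrite /dist in dn *.
  have := @nth_find _ 0%N (fun k => within g k u v) (iota 0 n).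
  by rewrite has_find size_iota nth_iota // => ->.
rewrite leqNgt; apply/negP => /(@before_find _ 0%N).
by rewrite nth_iota // add0n wk.
Qed.

Lemma radius_le k u : (k < n)%N -> (forall v, within g k u v) -> (radius g <= k)%N.
Proof.
move=> kn uP; apply: (@leq_trans (ecc g u)); last first.
  by apply/bigmax_leqP => v _; rewrite dist_le.
rewrite /radius; elim: (index_enum _) (mem_index_enum u) => // v s IHs.
rewrite in_cons big_cons => /predU1P[<-|/IHs us]; first exact: geq_minl.
exact: leq_trans (geq_minr _ _) us.
Qed.

Lemma radius_gt k : (k < n)%N -> (forall u, exists v, ~~ within g k u v) ->
  (k < radius g)%N.
Proof.
move=> kn far; rewrite /radius; elim/big_ind: _ => // [a b ka kb|u _].
  by rewrite leq_min ka.
have [v uv] := far u; apply: leq_trans (leq_bigmax v).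
by rewrite ltnNge dist_le.
Qed.

End Walks.

(** * The radius gadget *)

(* A row node (KA, i) reaches (KB, i) in three steps only along
   (KA, i) - (KA', j) - (KB', j) - (KB, i) with [x (i, j)] and [y (i, j)]; the
   nodes KC give short paths to all (KB, k) with k <> i, and KH to all (KA', j).
   The pendant paths ending in KR3 and KP3 force every other node to have
   eccentricity at least 4. Each kind has [m.+1] copies, and the nodes left over
   are further copies of KP3. *)
Inductive kind := KA | KA' | KB | KB' | KC | KH | KR2 | KR3 | KP1 | KP2 | KP3.

Section Gadget.
Variables (m n : nat).
Hypotheses (m_gt0 : (0 < m)%N) (n_ge : (11 * m.+1 <= n)%N).
Local Notation node := (kind * 'I_m.+1)%type.
Local Notation input := {ffun 'I_m.+1 * 'I_m.+1 -> bool}.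
Implicit Types (x y : input) (p q : node).

Definition kinds := [:: KA; KA'; KB; KB'; KC; KH; KR2; KR3; KP1; KP2; KP3].

Definition node_of (u : 'I_n) : node :=
  (nth KP3 kinds (u %/ m.+1), inord (u %% m.+1)).

Lemma node_of_surj p : exists u, node_of u = p.
Proof.
case: p => k i.
have [t t11 <-] : exists2 t, (t < 11)%N & nth KP3 kinds t = k.
  by case: k; [exists 0%N|exists 1%N|exists 2%N|exists 3%N|exists 4%N|exists 5%N
    |exists 6%N|exists 7%N|exists 8%N|exists 9%N|exists 10%N].
have un : (t * m.+1 + i < n)%N.
  apply: leq_trans n_ge; apply: leq_trans (_ : t.+1 * m.+1 <= _)%N.
    by rewrite mulSn addnC ltn_add2r.
  by rewrite leq_mul2r t11 orbT.
exists (Ordinal un); rewrite /node_of /= divnMDl // modnMDl.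
by rewrite divn_small // modn_small // addn0 inord_val.
Qed.

Definition link x y p q : bool :=
  match p.1, q.1 with
  | KA, KA' => x (p.2, q.2)
  | KB, KB' => y (p.2, q.2)
  | KA', KB' | KC, KB => p.2 == q.2
  | KA, KC => p.2 != q.2
  | KA, KH | KA', KH | KH, KR2 | KR2, KR3
  | KA, KP1 | KP1, KP2 | KP2, KP3 => true
  | _, _ => false
  end.

Definition adj x y p q := link x y p q || link x y q p.

Definition gadget x y : graph n := fun u v => adj x y (node_of u) (node_of v).

Lemma gadget_sym x y u v : gadget x y u v = gadget x y v u.
Proof. by rewrite /gadget /adj orbC. Qed.

Lemma gadget_simple x y : simple_graph (gadget x y).
Proof.
split=> [u v|u]; first exact: gadget_sym.
by rewrite /gadget /adj /link; case: (node_of u) => [[] i].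
Qed.

(** [node_of] is only surjective, so every copy of [q] has to be reached. *)
Definition near x y k u q := forall v, node_of v = q -> within (gadget x y) k u v.

Lemma near_edge x y u q : adj x y (node_of u) q -> near x y 1 u q.
Proof. by move=> uq v vq; apply: within_edge; rewrite /gadget vq. Qed.

Lemma near_step x y k u p q : near x y k u p -> adj x y p q -> near x y k.+1 u q.
Proof.
move=> up pq v vq; have [w wp] := node_of_surj p.
rewrite -addn1; apply: within_trans (up _ wp) _.
by apply: within_edge; rewrite /gadget wp vq.
Qed.

Lemma near_mono x y k l u q : (k <= l)%N -> near x y k u q -> near x y l u q.
Proof. by move=> kl uq v /uq; exact: within_mono. Qed.

Lemma near_from_row x y q u i : node_of u = (KA, i) ->
  near x y (if q.1 is KB then if q.2 == i then 4 else 3 else 3)%N u q.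
Proof.
move=> uE.
have nH j : near x y 1 u (KH, j) by apply: near_edge; rewrite uE.
have nP1 j : near x y 1 u (KP1, j) by apply: near_edge; rewrite uE.
have nA l : near x y 2 u (KA, l) by apply: near_step (nH ord0) _.
have nA' l : near x y 2 u (KA', l) by apply: near_step (nH ord0) _.
have nR2 l : near x y 2 u (KR2, l) by apply: near_step (nH ord0) _.
have nP2 l : near x y 2 u (KP2, l) by apply: near_step (nP1 ord0) _.
have nB' l : near x y 3 u (KB', l).
  by apply: near_step (nA' l) _; rewrite /adj /link /= eqxx.
have nC l : near x y 3 u (KC, l).
  (* Any row other than [l] is adjacent to [(KC, l)]; one exists since [m > 0]. *)
  pose l' : 'I_m.+1 := if l == ord0 then ord_max else ord0.
  apply: near_step (nA l') _; rewrite /adj /link /= orbF /l'.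
  by case: (eqVneq l ord0) => [->|]; [rewrite -val_eqE /= -lt0n | rewrite eq_sym].
have nC1 l : l != i -> near x y 1 u (KC, l).
  by move=> li; apply: near_edge; rewrite uE /adj /link /= eq_sym li.
case: q => -[] l /=; try by [exact: near_mono (nA l) | exact: near_mono (nA' l)
  | exact: nB' | exact: nC | exact: near_mono (nH l) | exact: near_mono (nR2 l)
  | exact: near_mono (nP1 l) | exact: near_mono (nP2 l)].
- case: eqP => [->|/eqP li].
    by apply: near_step (nC i) _; rewrite /adj /link /= eqxx.
  apply: (@near_mono _ _ 2) => //; apply: near_step (nC1 _ li) _.
  by rewrite /adj /link /= eqxx.
- by apply: near_step (nR2 ord0) _.
- by apply: near_step (nP2 ord0) _.
Qed.

Lemma gadget_connected x y : connectedg (gadget x y).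
Proof.
have [u uE] := node_of_surj (KA, ord0).
have u4 v : within (gadget x y) 4 u v.
  have := @near_from_row x y (node_of v) _ _ uE v (erefl _); apply: within_mono.
  by case: (node_of v) => [[] i] //=; case: ifP.
move=> v w; apply: (@within_mono _ _ (4 + 4)).
  by apply: leq_trans n_ge; rewrite mulnS.
by apply: within_trans (u4 w); apply: within_sym (u4 v) => *; apply: gadget_sym.
Qed.

Lemma gadget_radius_intersecting x y i j :
  x (i, j) -> y (i, j) -> (radius (gadget x y) <= 3)%N.
Proof.
move=> xij yij; have [u uE] := node_of_surj (KA, i).
apply: (@radius_le _ _ _ u) => [|v]; first by apply: leq_trans n_ge; rewrite mulnS.
have := @near_from_row x y (node_of v) _ _ uE v (erefl _).
case: (eqVneq (node_of v).2 i) => vi; last by case: (node_of v).1.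
case vk: (node_of v).1 => // _.
have vE : node_of v = (KB, i) by rewrite [LHS]surjective_pairing vi vk.
suff : near x y 3 u (KB, i) by apply.
have nA' : near x y 1 u (KA', j) by apply: near_edge; rewrite uE /adj /link /= xij.
have nB' : near x y 2 u (KB', j).
  by apply: near_step nA' _; rewrite /adj /link /= eqxx.
by apply: near_step nB' _; rewrite /adj /link /= yij.
Qed.

Lemma gadget_far x y (f : node -> nat) u p :
  (forall p q, link x y p q -> (f q <= (f p).+1) && (f p <= (f q).+1))%N ->
  (f (node_of u) + 3 < f p)%N -> exists v, ~~ within (gadget x y) 3 u v.
Proof.
move=> flip up; have [v vp] := node_of_surj p; exists v; apply/negP.
move=> /(within_lipschitz (f := fun v => f (node_of v))) uv.
move: up; rewrite ltnNge -vp uv // => w w'; rewrite /gadget /adj.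
by case/orP => /flip /andP[].
Qed.

(* Potentials changing by at most one along an edge: they bound from below the
   distances from KP3 and KR3 (truncated at 4) and from (KA, i) when row i of
   the inputs is disjoint. *)
Definition dist_P3 p : nat :=
  (match p.1 with KP3 => 0 | KP2 => 1 | KP1 => 2 | KA => 3 | _ => 4 end)%N.
Definition dist_R3 p : nat :=
  (match p.1 with KR3 => 0 | KR2 => 1 | KH => 2 | KA | KA' => 3 | _ => 4 end)%N.
Definition dist_row x i p : nat :=
  (match p.1 with
  | KA => if p.2 == i then 0 else 2
  | KA' => if x (i, p.2) then 1 else 2
  | KB' => if x (i, p.2) then 2 else 3
  | KC => if p.2 == i then 3 else 1
  | KB => if p.2 == i then 4 else 2
  | KH | KP1 => 1
  | KR2 | KP2 => 2
  | KR3 | KP3 => 3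
  end)%N.

(** Every kind but [KA] has potential 4 towards [KP3] or [KR3]; for [(KA, i)] the far node is
    [(KB, i)]. *)
Lemma gadget_radius_disjoint x y :
  (forall e, ~~ (x e && y e)) -> (3 < radius (gadget x y))%N.
Proof.
move=> xy; apply: radius_gt => [|u]; first by apply: leq_trans n_ge; rewrite mulnS.
have farP3 : (3 < dist_P3 (node_of u))%N -> exists v, ~~ within (gadget x y) 3 u v.
  move=> u4; apply: (@gadget_far _ _ (fun p => 4 - dist_P3 p)%N _ (KP3, ord0)).
    by move=> [[] i] [[] j].
  by move: u4; rewrite /dist_P3; case: (node_of u) => [[] i].
have farR3 : (3 < dist_R3 (node_of u))%N -> exists v, ~~ within (gadget x y) 3 u v.
  move=> u4; apply: (@gadget_far _ _ (fun p => 4 - dist_R3 p)%N _ (KR3, ord0)).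
    by move=> [[] i] [[] j].
  by move: u4; rewrite /dist_R3; case: (node_of u) => [[] i].
move: farP3 farR3; rewrite /dist_P3 /dist_R3; case uE: (node_of u) => [[] i] /=;
  try by (move=> /(_ isT) + _ || move=> _ /(_ isT)).
move=> _ _; apply: (@gadget_far _ _ (dist_row x i) _ (KB, i)); last first.
  by rewrite uE /dist_row /= eqxx.
move=> [k j] [k' j']; rewrite /link /dist_row; case: k; case: k' => //=.
- case: (eqVneq j i) => [->|_]; first by move=> ->.
  by case: (x (i, j')).
- by case: (eqVneq j i) => [->|ji]; case: (eqVneq j' i).
- by case: ifP.
- by case: ifP.
- by move=> /eqP ->; case: (x _).
- by case: ifP.
- case: (eqVneq j i) => [->|_ _]; last by case: (x _).
  (* Disjointness enters here: an edge from [(KB, i)] to [(KB', j')] means [y (i, j')], so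
     [x (i, j')] fails and [(KB', j')] has potential 3. *)
  by have := xy (i, j'); case: (x _) => //= /negbTE ->.
by move=> /eqP ->; case: ifP.
Qed.

Definition bob_side (k : kind) := if k is (KB | KB') then true else false.

Lemma gadget_local_alice x y y' u : ~~ bob_side (node_of u).1 ->
  local_input (gadget x y) u = local_input (gadget x y') u.
Proof.
move=> ub; apply/ffunP=> v; rewrite !ffunE /gadget /adj /link.
by case: (node_of u) ub => [[] i] //=; case: (node_of v) => [[] j].
Qed.

Lemma gadget_local_bob x x' y u : bob_side (node_of u).1 ->
  local_input (gadget x y) u = local_input (gadget x' y) u.
Proof.
move=> ub; apply/ffunP=> v; rewrite !ffunE /gadget /adj /link.
by case: (node_of u) ub => [[] i] //=; case: (node_of v) => [[] j].
Qed.

Lemma gadget_local_P3 x y x' y' u : (node_of u).1 = KP3 ->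
  local_input (gadget x y) u = local_input (gadget x' y') u.
Proof.
move=> uk; apply/ffunP=> v; rewrite !ffunE /gadget /adj /link.
by case: (node_of u) uk => [[] i] //= _; case: (node_of v) => [[] j].
Qed.

End Gadget.

(** * Transcripts *)

Section Protocol.
Variables (S : Type) (n b K : nat) (A : bcc_alg S n b K).

Lemma size_transcript g seed t : size (transcript A g seed t) == t.
Proof. by elim: t => //= t /eqP IH; rewrite size_rcons IH. Qed.

(** By induction on rounds: with equal histories, each node of [g] sends what it sends in [g1] or in
    [g2], and these messages agree. *)
Lemma transcript_cut_paste g g1 g2 seed t :
  (forall u, local_input g u = local_input g1 u \/ local_input g u = local_input g2 u) ->
  transcript A g1 seed t = transcript A g2 seed t ->
  transcript A g seed t = transcript A g1 seed t.
Proof.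
move=> gg; elim: t => //= t IHt /rcons_inj[tE mE]; rewrite IHt //.
congr rcons; apply/ffunP=> u; rewrite !ffunE.
case: (gg u) => -> //; move/ffunP: mE => /(_ u); rewrite !ffunE => ->.
by rewrite tE.
Qed.

End Protocol.

(** * From radius approximation to disjointness *)

Section RadiusLowerBound.
Variables (R : realType) (eps : R) (m n b K T : nat) (A : bcc_alg R n b K).
Hypotheses (eps_gt0 : 0 < eps) (eps_le : eps <= 3^-1).
Hypotheses (m_gt0 : (0 < m)%N) (n_ge : (11 * m.+1 <= n)%N) (K_gt0 : (0 < K)%N).
Hypothesis A_approx : bcc_radius_approx A T (4 / 3 - eps).
Local Notation input := {ffun 'I_m.+1 * 'I_m.+1 -> bool}.
Local Notation seeds := {ffun 'I_n -> 'I_K}.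
Local Notation inst := (@gadget m n).
Implicit Types (x y : input) (s : seeds).

(** Fixing the seeds makes the protocol deterministic, so that transcripts have the rectangle
    property. *)
Definition gadget_transcript s x y : T.-tuple (round_msgs n b) :=
  Tuple (size_transcript A (inst x y) s T).

Lemma gadget_transcript_rect s x y x' y' :
  gadget_transcript s x y' = gadget_transcript s x' y ->
  gadget_transcript s x y = gadget_transcript s x y'.
Proof.
move=> /(congr1 val) /= e; apply: val_inj => /=.
apply: (transcript_cut_paste (g2 := inst x' y)) e => u.
case: (boolP (bob_side (node_of m u).1)) => ub; [right|left].
  exact: gadget_local_bob.
exact: gadget_local_alice.
Qed.

(* The neighbourhood of a node of kind KP3 is independent of the inputs, so its
   output is a function of the transcript. *)
Variable u0 : 'I_n.
Hypothesis u0P3 : (node_of m u0).1 = KP3.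

Definition says_large s (tr : T.-tuple (round_msgs n b)) : bool :=
  4 <= bcc_out A u0 (local_input (inst [ffun=> false] [ffun=> false]) u0) (s u0) tr.

Lemma says_largeE s x y :
  says_large s (gadget_transcript s x y) = (4 <= bcc_output A (inst x y) s T u0).
Proof. by rewrite /says_large /bcc_output (gadget_local_P3 _ _ x y u0P3). Qed.

Lemma card_success x y : 2 / 3 * (K ^ n)%:R <=
  \sum_s (bcc_success A (inst x y) T (4 / 3 - eps) s)%:R :> R.
Proof.
have := A_approx (@gadget_simple m n x y) (gadget_connected m_gt0 n_ge x y).
rewrite -(ler_nat R) !natrM.
have -> : \sum_s (bcc_success A (inst x y) T (4 / 3 - eps) s)%:R =
   #|[set s | bcc_success A (inst x y) T (4 / 3 - eps) s]|%:R :> R.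
  rewrite -natr_sum -sum1_card [in RHS]big_mkcond /=; congr _%:R.
  by apply: eq_bigr => s _; rewrite inE; case: (bcc_success _ _ _ _ _).
lra.
Qed.

Lemma says_large_disjoint x y : (forall e, ~~ (x e && y e)) ->
  2 / 3 * (K ^ n)%:R <= \sum_s (says_large s (gadget_transcript s x y))%:R :> R.
Proof.
move=> xy; apply: le_trans (card_success x y) _; apply: ler_sum => s _.
rewrite ler_nat says_largeE; case ok: (bcc_success _ _ _ _ _) => //.
have /andP[r4 _] := forallP ok u0; rewrite (le_trans _ r4) //.
by rewrite ler_nat gadget_radius_disjoint.
Qed.

(** A successful run outputs at most [3 * (4 / 3 - eps) < 4], so [says_large] holds only for failing
    seeds. *)
Lemma says_large_intersecting x y e : x e -> y e ->
  \sum_s (says_large s (gadget_transcript s x y))%:R <= 1 / 3 * (K ^ n)%:R :> R.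
Proof.
case: e => i j xe ye; have ok := card_success x y.
have : \sum_s ((says_large s (gadget_transcript s x y))%:R
    + (bcc_success A (inst x y) T (4 / 3 - eps) s)%:R) <= \sum_(s : seeds) 1 :> R.
  apply: ler_sum => s _; rewrite says_largeE.
  case ok_s: (bcc_success _ _ _ _ _); last by rewrite addr0 lern1; case: (4 <= _).
  have /andP[_ r3] := forallP ok_s u0.
  have r3' : (radius (inst x y))%:R <= 3 :> R.
    by rewrite ler_nat (gadget_radius_intersecting m_gt0 n_ge xe ye).
  suff /negbTE -> : ~~ (4 <= bcc_output A (inst x y) s T u0) by rewrite add0r.
  rewrite -ltNge; apply: le_lt_trans r3 _.
  have [e0 e1] := (eps_gt0, eps_le); have a0 : 0 <= 4 / 3 - eps by lra.
  by apply: le_lt_trans (ler_wpM2l a0 r3') _; lra.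
rewrite big_split sumr_const card_ffun !card_ord /=; lra.
Qed.

(** Sum [unique_disjointness] over all seeds: the average gap is at least 1/3, and at most
    [384 * c / #|I| + 1 / 6] with [c = b * n * T]; hence the constant 2304 = 6 * 384. *)
Lemma transcripts_vs_inputs : (m.+1 * m.+1 <= 2304 * (b * n * T))%N.
Proof.
have cardW : (#|{: T.-tuple (round_msgs n b)}| <= 2 ^ (b * n * T))%N.
  by rewrite card_tuple card_ffun !card_ord -!expnM mulnA.
set I := ('I_m.+1 * 'I_m.+1)%type.
have cardI : #|{: I}| = (m.+1 * m.+1)%N by rewrite card_prod card_ord.
pose Kn : R := (K ^ n)%:R; pose N : R := 2 ^+ #|{: I}|.
have Kn_gt0 : 0 < Kn by rewrite ltr0n expn_gt0 K_gt0.
have N_gt0 : 0 < N by rewrite exprn_gt0.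
pose gap s (D : input) (i : I) (z : input) : R :=
  (says_large s (gadget_transcript s (alice D z i false) (bob D z i false)))%:R
  - (says_large s (gadget_transcript s (alice D z i true) (bob D z i true)))%:R.
have up : \sum_s \sum_D \sum_i \sum_z gap s D i z <=
    \sum_(s : seeds) (384 * (b * n * T)%:R + #|{: I}|%:R / 6) * (N * N).
  apply: ler_sum => s _; apply: unique_disjointness cardW.
  exact: gadget_transcript_rect.
have low : \sum_(D : input) \sum_(i : I) \sum_(z : input) (1 / 3 * Kn) <=
    \sum_s \sum_D \sum_i \sum_z gap s D i z.
  rewrite [leRHS]exchange_big; apply: ler_sum => D _ /=.
  rewrite [leRHS]exchange_big; apply: ler_sum => i _ /=.
  rewrite [leRHS]exchange_big; apply: ler_sum => z _ /=.
  rewrite sumrB.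
  have := @says_large_disjoint (alice D z i false) (bob D z i false).
  have := @says_large_intersecting (alice D z i true) (bob D z i true) i.
  rewrite !ffunE eqxx -/Kn => /(_ isT isT) h1 h0.
  have disj : forall e, ~~ (alice D z i false e && bob D z i false e).
    by move=> e; rewrite !ffunE; case: eqP => // _; case: (D e); rewrite ?andbF.
  by have := h0 disj; lra.
move: low; under eq_bigr do under eq_bigr do rewrite sum_cube_const.
under eq_bigr do rewrite sumr_const -[_ *+ _]mulr_natl.
rewrite sum_cube_const -/N => low.
move: up; rewrite sumr_const card_ffun !card_ord -[_ *+ (K ^ n)]mulr_natl -/Kn => up.
have := le_trans low up; rewrite cardI.
have -> : (m.+1 * m.+1)%:R * (1 / 3 * Kn * N) * N
  = Kn * (N * N) * ((m.+1 * m.+1)%:R / 3) by field.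
rewrite [leRHS]mulrCA [leRHS]mulrC ler_pM2l ?mulr_gt0 // => le_real.
by rewrite -(ler_nat R) natrM; lra.
Qed.

End RadiusLowerBound.

(* For eps in (0,1/3] and any O(log n) message size (C log n bits), there are
   constants c, k, N such that every BCC algorithm computing a
   (4/3 - eps)-approximation of the radius w.p. >= 2/3 in T rounds has
   T >= n / (c * log^k n), i.e. T = Omega~(n). *)
Theorem theorem29 (R : realType) (eps : R) :
  0 < eps -> eps <= 3^-1 ->
  forall C : nat, exists c k N : nat,
    forall (n b K T : nat) (A : bcc_alg R n b K),
      (N <= n)%N -> (b <= C * up_log 2 n)%N -> (0 < K)%N ->
      bcc_radius_approx A T (4 / 3 - eps) ->
      (n <= c * T * (up_log 2 n) ^ k)%N.
Proof.
(* The threshold 22 gives each kind at least two copies; 484 is the square of 22 in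
   [n <= 22 * m.+2]. *)
move=> eps_gt0 eps_le C; exists (484 * 2304 * C)%N, 1%N, 22%N.
move=> n b K T A n22 bC K_gt0 A_approx; rewrite expn1.
have [m mE] : exists m, (n %/ 11 = m.+2)%N.
  have : (1 < n %/ 11)%N by rewrite leq_divRL.
  by case: (n %/ 11)%N => [|[|m]] // _; exists m.
have nE := divn_eq n 11; have n_mod : (n %% 11 < 11)%N by rewrite ltn_mod.
have n_ge : (11 * m.+2 <= n)%N by rewrite -mE mulnC leq_trunc_div.
have n_le : (n <= 22 * m.+2)%N by rewrite nE mE; lia.
have [u0 u0E] := node_of_surj n_ge (KP3, ord0).
have := transcripts_vs_inputs eps_gt0 eps_le (isT : 0 < m.+1)%N n_ge K_gt0 A_approx
          (congr1 fst u0E).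
move=> mm; have n_gt0 : (0 < n)%N by apply: leq_trans n22.
(* Multiplying by [n] allows comparing [n * n] with the number of input bits, which is at most
   [2304 * (b * n * T)]. *)
rewrite -(leq_pmul2l n_gt0).
apply: leq_trans (leq_mul n_le n_le) _.
rewrite mulnACA; apply: leq_trans (leq_mul (leqnn _) mm) _.
apply: leq_trans (_ : 22 * 22 * (2304 * (C * up_log 2 n * n * T)) <= _)%N.
  by rewrite !leq_mul.
apply: eq_leq; rewrite (_ : 484 = 22 * 22)%N //; lia.
Qed.
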